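(* Let $n\ge 1$. The map $\Pi$ is a bijection between the set of distinguished bases (of positive roots) of the $A_n$ root system and the set of maximal chains of non-crossing partitions of $\{0,1,\ldots,n\}$, and for every distinguished basis $A$ $$\Lambda(\Pi(A))+(1,\ldots,1)=\mathbf{in}(A).$$
   Context: Let $e_1,\ldots,e_n$ be the positive simple roots of the $A_n$ root system; the positive roots are $e_{ij}=e_i+\cdots+e_j$, $1\le i\le j\le n$. The Seifert form is the bilinear form on the root lattice with $\langle e_i,e_i\rangle=1$, $\langle e_i,e_{i+1}\rangle=-1$, $\langle e_i,e_j\rangle=0$ for $j\ne i,i+1$. A distinguished basis (of positive roots) is an ordered basis $A=(a_1,\ldots,a_n)$ of the root lattice consisting of positive roots with $\langle a_j,a_i\rangle=0$ for all $j>i$. For a positive root put $\mathbf{in}(e_{ij})=i$, and $\mathbf{in}(A)=(\mathbf{in}(a_1),\ldots,\mathbf{in}(a_n))$. A non-crossing partition of $\{0,1,\ldots,n\}$ is a set partition such that if $a<b<c<d$, a block $B$ contains $a$ and $c$, and a block $B'$ contains $b$ and $d$, then $B=B'$. These are partially ordered by refinement: $\pi\preceq\sigma$ if $\pi$ is a refinement of $\sigma$. Map $\Pi$: to the root $e_{ij}$ associate the arc (edge) joining $i-1$ and $j$ on the vertex set $\{0,1,\ldots,n\}$. For a distinguished basis $A$ and $0\le k\le n$, let $\pi_k$ be the partition of $\{0,\ldots,n\}$ into connected components of the graph with edges the arcs of $a_1,\ldots,a_k$; put $\Pi(A)=(\pi_0\prec\pi_1\prec\cdots\prec\pi_n)$.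 Map $\Lambda$: if $\sigma$ is an immediate successor of $\pi$, obtained by merging two blocks $B,B'$ of $\pi$ with $\min B<\min B'$, put $\Lambda(\pi,\sigma)=\max\{i\in B: i<b' \text{ for all } b'\in B'\}$. For a maximal chain $\pi_0\prec\pi_1\prec\cdots\prec\pi_n$ put $\Lambda=(\Lambda(\pi_0,\pi_1),\ldots,\Lambda(\pi_{n-1},\pi_n))$. *)

(* Defs.v *)
From mathcomp Require Import all_boot all_order all_algebra.

Set Implicit Arguments.
Unset Strict Implicit.
Unset Printing Implicit Defensive.

Import GRing.Theory.
Local Open Scope ring_scope.

(* The root lattice of A_n is 'rV[int]_n. Indices are 0-based: i : 'I_n stands
   for the index i + 1 of the simple root e_{i+1}. *)
Definition simple_root (n : nat) (i : 'I_n) : 'rV[int]_n := delta_mx 0 i.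

(* The pair (i, j) with i <= j stands for the root e_{i+1} + ... + e_{j+1};
   root_vec_inj shows that positive roots may be identified with such pairs. *)
Definition pos_root (n : nat) := {r : 'I_n * 'I_n | (r.1 <= r.2)%N}.

Definition root_vec (n : nat) (r : pos_root n) : 'rV[int]_n :=
  \sum_(k < n | ((val r).1 <= k <= (val r).2)%N) simple_root k.

Lemma root_vecE (n : nat) (r : pos_root n) (k : 'I_n) :
  root_vec r 0 k = (((val r).1 <= k <= (val r).2)%N : nat)%:Z.
Proof.
rewrite /root_vec summxE; have [Hk|Hk] := boolP ((val r).1 <= k <= (val r).2)%N.
  rewrite (bigD1 k) //= big1 ?addr0 ?mxE ?eqxx // => i /andP[_ ik].
  by rewrite mxE eqxx /= eq_sym (negbTE ik).
rewrite big1 // => i Hi; rewrite mxE eqxx /=.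
by case: eqP => // ki; rewrite ki Hi in Hk.
Qed.

Lemma root_vec_inj (n : nat) : injective (@root_vec n).
Proof.
move=> [[i j] /= ij] [[i' j'] /= ij'] E.
have H (k : 'I_n) : (i <= k <= j)%N = (i' <= k <= j')%N.
  move/matrixP: E => /(_ 0 k); rewrite !root_vecE /=.
  by case: (_ && _); case: (_ && _).
have := H i; have := H j; have := H i'; have := H j'.
rewrite !leqnn ij ij' !andbT /= => /andP[_ H1] /andP[H2 _].
move=> /esym/andP[_ H3] /esym/andP[H4 _].
apply: val_inj => /=.
by congr pair; apply: val_inj; apply/eqP; rewrite eqn_leq ?H1 ?H2 ?H3 ?H4.
Qed.

Definition seifert_mx (n : nat) : 'M[int]_n :=
  \matrix_(i, j) (if i == j then 1 else if (j == i.+1 :> nat) then -1 else 0).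

Definition seifert (n : nat) (u v : 'rV[int]_n) : int :=
  (u *m seifert_mx n *m v^T) 0 0.

Definition lattice_basis (n : nat) (b : 'I_n -> 'rV[int]_n) : Prop :=
  forall x : 'rV[int]_n, exists! c : 'rV[int]_n, x = \sum_(i < n) c 0 i *: b i.

Definition distinguished (n : nat) (A : n.-tuple (pos_root n)) : Prop :=
  lattice_basis (fun i => root_vec (tnth A i)) /\
  (forall i j : 'I_n, (i < j)%N ->
     seifert (root_vec (tnth A j)) (root_vec (tnth A i)) = 0).

(* in(e_{ij}) = i, in the 1-based indexing of the simple roots. *)
Definition root_in (n : nat) (r : pos_root n) : nat := (val r).1.+1.

Local Close Scope ring_scope.

Definition noncrossing (n : nat) (P : {set {set 'I_n.+1}}) : bool :=
  partition P [set: 'I_n.+1] &&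
  [forall B in P, forall B' in P,
     [exists a in B, exists c in B, exists b in B', exists d in B',
        [&& a < b, b < c & c < d]] ==> (B == B')].

Definition refines (T : finType) (P Q : {set {set T}}) : bool :=
  [forall B in P, exists C in Q, B \subset C].

Definition strictly_refines (T : finType) : rel {set {set T}} :=
  fun P Q => refines P Q && (P != Q).

(* A chain is listed in increasing order, so that chains as sets and chains as
   sequences are in bijection. *)
Definition nc_chain (n : nat) (c : seq {set {set 'I_n.+1}}) : Prop :=
  all (@noncrossing n) c /\ sorted (@strictly_refines 'I_n.+1) c.

Definition maximal_nc_chain (n : nat) (c : seq {set {set 'I_n.+1}}) : Prop :=
  nc_chain c /\
  (forall c' : seq {set {set 'I_n.+1}},
     nc_chain c' -> {subset c <= c'} -> c' = c).

(* The arc of e_{ij} joins i - 1 and j; with 0-based i and j, these are the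
   vertices i and j + 1. *)
Definition arc_source (n : nat) (r : pos_root n) : 'I_n.+1 :=
  widen_ord (leqnSn n) (val r).1.

Definition arc_target (n : nat) (r : pos_root n) : 'I_n.+1 :=
  lift ord0 (val r).2.

Definition arc_rel (n : nat) (s : seq (pos_root n)) : rel 'I_n.+1 :=
  fun x y => has (fun r => ((x == arc_source r) && (y == arc_target r)) ||
                           ((y == arc_source r) && (x == arc_target r))) s.

Definition arc_components (n : nat) (s : seq (pos_root n)) :
    {set {set 'I_n.+1}} :=
  equivalence_partition (connect (arc_rel s)) [set: 'I_n.+1].

Definition Pi_map (n : nat) (A : n.-tuple (pos_root n)) :
    seq {set {set 'I_n.+1}} :=
  mkseq (fun k => arc_components (take k A)) n.+1.

(* The minimum of a nonempty B; the neutral element n bounds all of 'I_n.+1. *)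
Definition block_min (n : nat) (B : {set 'I_n.+1}) : nat :=
  \big[minn/n]_(i in B) i.

Definition merges (n : nat) (P Q : {set {set 'I_n.+1}})
    (B B' : {set 'I_n.+1}) : bool :=
  [&& B \in P, B' \in P, block_min B < block_min B' &
      Q == (B :|: B') |: (P :\ B :\ B')].

(* When Q is obtained from P by merging two blocks, the pair (B, B') is unique;
   the value 0 in the other case is irrelevant. *)
Definition Lambda_step (n : nat) (P Q : {set {set 'I_n.+1}}) : nat :=
  if [pick BB : {set 'I_n.+1} * {set 'I_n.+1} | merges P Q BB.1 BB.2] is Some BB
  then \max_(i in BB.1 | [forall b' in BB.2, i < b']) i
  else 0.

Definition Lambda_map (n : nat) (c : seq {set {set 'I_n.+1}}) : seq nat :=
  if c is P :: c' then pairmap (@Lambda_step n) P c' else [::].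

(* Main.v *)
Require Import Defs.
From mathcomp Require Import all_boot all_order all_algebra.
From mathcomp Require Import zify.

Set Implicit Arguments.
Unset Strict Implicit.
Unset Printing Implicit Defensive.

Import GRing.Theory.

(** Write a positive root as an arc [s < t] on the vertices, and let its cut be
    the set of vertices [x] with [s < x <= t].  A telescoping sum computes the
    Seifert form of the root of this arc against the root of an arc [s' < t']:
    it is the difference of the indicator values of the cut at [t'] and at
    [s'] ([seifert_root_vec]).  So the later root is orthogonal to the earlier
    one exactly when its cut contains both ends of the earlier arc or neither,
    and it is orthogonal to all the earlier roots exactly when its cut is a
    union of connected components of the graph of the earlier arcs
    ([compatible_saturated]); the cut is then called saturated.  As the form
    takes the value 1 on every root, the Gram matrix of a sequence of roots
    satisfying these orthogonality relations is unitriangular; when there are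
    [n] of them they therefore form a basis of the root lattice
    ([seifert_triangular_basis]).  Distinguished bases thus become sequences
    of [n] arcs, each with a saturated cut.

    Let the cut of [s < t] be saturated for a non-crossing partition, and let
    [B] and [B'] be the blocks of [s] and [t].  Then [B'] lies inside the cut
    and [B] avoids it, so that [t] is the maximum of [B'], and [s] is the
    largest element of [B] lying below all of [B'].  This has three
    consequences.  Merging [B] and [B'] creates no crossing
    ([noncrossing_merge]), so prefixes of a distinguished basis give
    non-crossing partitions.  The arc is determined by the partitions before
    and after the merge ([saturated_merge_inj]), so [Pi_map] is injective.  And
    [Lambda] reads off [s], which is the index of the root up to a shift
    ([Lambda_step_rcons]).

    Each arc merges two blocks, so [n] arcs lead from the partition into
    singletons to the partition with one block, and no partition fits strictly
    between two consecutive ones ([arc_components_rcons_cover]); hence the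
    resulting chain is maximal ([Pi_map_maximal]).  For surjectivity, the key
    fact is that between a non-crossing partition and a strictly coarser one
    there is always an arc with saturated cut whose ends belong to the same
    block of the coarser one ([exists_saturated_interval]).  Adding such arcs
    one at a time, steered by the next member of a given chain, embeds every
    chain into the image of some distinguished basis ([nc_chain_extension]); a
    maximal chain has to equal that image. *)

(** * Equivalence relations and partitions *)

Lemma equiv_refl (T : Type) (e : rel T) : equivalence_rel e -> reflexive e.
Proof. by case/equivalence_relP. Qed.

Lemma equiv_sym (T : Type) (e : rel T) : equivalence_rel e -> symmetric e.
Proof.
case/equivalence_relP=> refl ltrans x y.
by apply/idP/idP => /[dup] /ltrans <-; rewrite refl.
Qed.

Lemma equiv_trans (T : Type) (e : rel T) : equivalence_rel e -> transitive e.
Proof. by case/equivalence_relP=> _ ltrans y x z /ltrans ->. Qed.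

Definition merge_rel (T : Type) (e : rel T) (s t : T) : rel T :=
  fun x y => [|| e x y, e x s && e t y | e x t && e s y].

Lemma merge_rel_sub (T : Type) (e E : rel T) (s t : T) :
  equivalence_rel E -> subrel e E -> E s t -> subrel (merge_rel e s t) E.
Proof.
move=> equiv_E eE st x y.
have [E_sym E_trans] := (equiv_sym equiv_E, equiv_trans equiv_E).
case/or3P=> [/eE // | /andP[/eE xs /eE ty] | /andP[/eE xt /eE sy]].
  exact: E_trans xs (E_trans _ _ _ st ty).
by rewrite E_sym in st; exact: E_trans xt (E_trans _ _ _ st sy).
Qed.

(** Statements about partitions are proved for the corresponding equivalence
    relations, on which merging and crossing are elementary case analyses. *)
Definition same_block (T : finType) (P : {set {set T}}) : rel T :=
  fun x y => y \in pblock P x.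

Lemma same_block_equiv (T : finType) (P : {set {set T}}) :
  partition P [set: T] -> equivalence_rel (same_block P).
Proof.
case/and3P=> /eqP covP tiP _; apply/equivalence_relP; split=> [x|x y xy z].
  by rewrite /same_block mem_pblock covP.
by rewrite /same_block (same_pblock tiP xy).
Qed.

Lemma same_block_inj (T : finType) (P Q : {set {set T}}) :
  partition P [set: T] -> partition Q [set: T] ->
  same_block P =2 same_block Q -> P = Q.
Proof.
move=> partP partQ PQ; rewrite -(equivalence_partition_pblock partP).
rewrite -(equivalence_partition_pblock partQ).
apply: eq_imset => x; apply/setP => y; rewrite !inE.
exact: PQ.
Qed.

Lemma refinesP (T : finType) (P Q : {set {set T}}) :
  partition P [set: T] -> partition Q [set: T] ->
  reflect (subrel (same_block P) (same_block Q)) (refines P Q).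
Proof.
move=> /and3P[/eqP covP tiP P0] /and3P[/eqP covQ tiQ _].
apply: (iffP forall_inP) => [PQ x y xy | PQ B BP].
  have xP : x \in cover P by rewrite covP.
  have /exists_inP[C CQ /subsetP BC] := PQ _ (pblock_mem xP).
  rewrite /same_block (def_pblock tiQ CQ) ?BC //.
  by rewrite mem_pblock.
have [x xB] : exists x, x \in B by apply/set0Pn; apply: contraNneq P0 => <-.
apply/exists_inP; exists (pblock Q x); first by rewrite pblock_mem ?covQ.
apply/subsetP => y yB; apply: PQ.
by rewrite /same_block (def_pblock tiP BP xB).
Qed.

Lemma refines_trans (T : finType) : transitive (@refines T).
Proof.
move=> Q P R /forall_inP PQ /forall_inP QR; apply/forall_inP => B /PQ.
case/exists_inP=> C /QR/exists_inP[D DR CD] BC.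
by apply/exists_inP; exists D => //; apply: subset_trans CD.
Qed.

Lemma refines_anti (T : finType) (P Q : {set {set T}}) :
  partition P [set: T] -> partition Q [set: T] ->
  refines P Q -> refines Q P -> P = Q.
Proof.
move=> partP partQ /(refinesP partP partQ) PQ /(refinesP partQ partP) QP.
by apply: same_block_inj => // x y; apply/idP/idP; [apply: PQ | apply: QP].
Qed.

(** * Non-crossing equivalences and saturated intervals *)

Definition noncrossing_rel (m : nat) (e : rel 'I_m) : Prop :=
  forall a b c d : 'I_m, a < b -> b < c -> c < d -> e a c -> e b d -> e a b.

Definition cut (m : nat) (s t x : 'I_m) : bool := s < x <= t.

Definition saturated (m : nat) (e : rel 'I_m) (s t : 'I_m) : Prop :=
  forall x y, e x y -> cut s t x = cut s t y.

Lemma ord_leVlt (m : nat) (x y : 'I_m) : x <= y -> x = y \/ x < y.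
Proof. by rewrite leq_eqVlt => /orP[/eqP/val_inj|]; [left | right]. Qed.

Lemma saturated_target_max (m : nat) (e : rel 'I_m) (s t x : 'I_m) :
  s < t -> saturated e s t -> e t x -> s < x <= t.
Proof. by move=> st sat /sat; rewrite /cut st leqnn => /esym. Qed.

Lemma saturated_source_out (m : nat) (e : rel 'I_m) (s t x : 'I_m) :
  saturated e s t -> e s x -> (x <= s) || (t < x).
Proof. by move=> sat /sat; rewrite /cut ltnn /= => /esym/negbT; lia. Qed.

(** The class of [t] lies inside the saturated interval and the class of [s]
    outside it.  Four points of a crossing in the merged relation that are
    linked across the two classes therefore have forced positions with respect
    to [s] and [t], and replacing one of them by [s] or [t] produces a crossing
    of [e]. *)
Lemma noncrossing_merge (m : nat) (e : rel 'I_m) (s t : 'I_m) :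
  equivalence_rel e -> noncrossing_rel e -> s < t -> saturated e s t ->
  noncrossing_rel (merge_rel e s t).
Proof.
move=> equiv_e nc st sat; have e_refl := equiv_refl equiv_e.
have [e_sym e_trans] := (equiv_sym equiv_e, equiv_trans equiv_e).
have inT x : e t x -> s < x <= t := saturated_target_max st sat.
have outS x : e s x -> (x <= s) || (t < x) := saturated_source_out sat.
have inT' x : e x t -> s < x <= t by rewrite e_sym; apply: inT.
have outS' x : e x s -> (x <= s) || (t < x) by rewrite e_sym; apply: outS.
have satE x y : e x y -> (s < x <= t) = (s < y <= t) := @sat x y.
move=> a b c d ab bc cd.
rewrite /merge_rel.
case/or3P=> [ac | /andP[aS tc] | /andP[aT sc]];
  case/or3P=> [bd | /andP[bS td] | /andP[bT sd]].
- by rewrite (nc _ _ _ _ ab bc cd).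
- have := inT _ td; have := outS' _ bS.
  have := satE _ _ ac => satac outb ind.
  have /ord_leVlt[cs|cs] : c <= s by lia.
    by rewrite (e_trans c) // cs e_sym.
  by rewrite (nc a b c s).
- have := outS _ sd; have := inT' _ bT => inb outd.
  have satac := satE _ _ ac.
  case: (leqP a s) => as_.
    have aS : e a s.
      case: (ord_leVlt as_) => [-> //|lt_as]; apply: (nc _ _ c d) => //.
      by case/andP: inb => sb _; apply: ltn_trans bc.
    by rewrite aS [e t b]e_sym bT !orbT.
  have /ord_leVlt[ct|ct] : c <= t by lia.
    by rewrite (e_trans c) // ct e_sym.
  by rewrite (nc a b c t).
- have := inT _ tc; have := outS' _ aS => outa inc.
  have satbd := satE _ _ bd.
  rewrite aS /=; case: (leqP b s) => bs.
    case: (ord_leVlt bs) => [-> | lt_bs]; first by rewrite aS.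
    by rewrite (nc a b s d) //; lia.
  have /ord_leVlt[dt|dt] : d <= t by lia.
    by rewrite -dt [e d b]e_sym bd !orbT.
  rewrite (e_trans c t b) ?orbT // e_sym; apply: (nc b c d t) => //.
  by rewrite e_sym.
- by rewrite (e_trans s a b) // e_sym.
- by rewrite aS [e t b]e_sym bT orbT.
- have := outS _ sc; have := inT' _ aT => ina outc.
  have satbd := satE _ _ bd.
  by rewrite aT (nc s b c d) ?orbT //; lia.
- by rewrite aT [e s b]e_sym bS !orbT.
- by rewrite (e_trans t a b) // e_sym.
Qed.

(** Among the class minima of [e] that are not class minima of [E], let [m1] be
    the largest; take for [t] the maximum of the [e]-class of [m1] and for [s]
    the predecessor of [m1] in its [E]-class.  An [E]-class other than that of
    [m1] which meets the interval stays inside it, as otherwise it would cross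
    the pair [s], [t].  A point [x] of the interval in the [E]-class of [m1]
    satisfies [m1 <= x <= t].  The minimum of its [e]-class is at most [m1] by
    the choice of [m1]; if it is smaller, then [x] is [m1] or [t], or else the
    minimum and [x] cross the pair [m1], [t].  In all cases [x] is
    [e]-equivalent to [m1], so its class stays between [m1] and [t]. *)
Lemma exists_saturated_interval (m : nat) (e E : rel 'I_m) :
  equivalence_rel e -> equivalence_rel E -> subrel e E ->
  noncrossing_rel e -> noncrossing_rel E -> ~ subrel E e ->
  exists s t : 'I_m, [/\ s < t, E s t & saturated e s t].
Proof.
move=> equiv_e equiv_E.
have e_refl := equiv_refl equiv_e.
have [e_sym e_trans] := (equiv_sym equiv_e, equiv_trans equiv_e).
have [E_sym E_trans] := (equiv_sym equiv_E, equiv_trans equiv_E).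
move=> eE nc_e nc_E Ee.
pose least x := [forall y, e x y ==> (x <= y)].
have leastP x : reflect (forall y, e x y -> x <= y) (least x).
  by apply: (iffP forallP) => H y; have := H y; [move/implyP | move/implyP].
have has_least x : exists2 y, e x y & least y.
  case: (arg_minnP (fun y : 'I_m => y : nat) (e_refl x)) => y xy ymin.
  by exists y => //; apply/leastP => z yz; apply/ymin/(e_trans y).
pose cand x := least x && [exists y : 'I_m, (y < x) && E x y].
have [m0 cand0] : exists x, cand x.
  have /existsP[x /existsP[y /andP[Exy exy]]] :
      [exists x, exists y, E x y && ~~ e x y].
    apply: contraT; rewrite negb_exists => /forallP H; case: Ee => x y.
    have := H x; rewrite negb_exists => /forallP/(_ y).
    by case: (E x y); case: (e x y).
  have [x' xx' lx] := has_least x; have [y' yy' ly] := has_least y.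
  have Exy' : E x' y'.
    apply: (E_trans x); first by rewrite E_sym; apply: eE.
    by apply: (E_trans y) => //; apply: eE.
  case: (ltngtP x' y') => [lt|lt|/val_inj eq].
  - by exists y'; rewrite /cand ly; apply/existsP; exists x'; rewrite lt E_sym.
  - by exists x'; rewrite /cand lx; apply/existsP; exists y'; rewrite lt.
  - by move: exy; rewrite (e_trans x') // eq e_sym.
case: (arg_maxnP (fun y : 'I_m => y : nat) cand0) => m1 /andP[/leastP m1_least].
case/existsP=> s0 s0P m1_max.
pose below (y : 'I_m) := (y < m1) && E m1 y.
case: (@arg_maxnP _ s0 below (fun y : 'I_m => y : nat) s0P).
move=> s /andP[sm1 m1s] s_max.
case: (arg_maxnP (fun y : 'I_m => y : nat) (e_refl m1)) => t m1t t_max.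
have m1_le_t := t_max m1 (e_refl m1).
have Em1t : E m1 t := eE _ _ m1t.
have Est : E s t by apply: (E_trans m1) => //; rewrite E_sym.
exists s, t; split=> //; first exact: leq_trans sm1 m1_le_t.
have sat1 x y : e x y -> s < x <= t -> s < y <= t.
  move=> xy x_in; have Exy := eE _ _ xy.
  have [Em1x|Em1x] := boolP (E m1 x); last first.
    have Em1y : ~~ E m1 y.
      by apply: contra Em1x => m1y; rewrite (E_trans y) // E_sym.
    have xt : x < t.
      have /ord_leVlt[xt|//] : x <= t by case/andP: x_in.
      by move: Em1x; rewrite xt Em1t.
    case: (leqP y s) => [/ord_leVlt[ys|ys]|ys].
    - by move: Em1y; rewrite ys m1s.
    - case/negP: Em1x; apply: (E_trans s) => //; rewrite E_sym.
      rewrite (E_trans y) //.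
      apply: (nc_E y s x t) => //; first by case/andP: x_in.
      by rewrite E_sym.
    rewrite /= leqNgt; apply/negP => ty.
    case/negP: Em1x; apply: (E_trans s) => //.
    by case/andP: x_in => sx _; apply: (nc_E s x t y).
  have m1x : m1 <= x.
    rewrite leqNgt; apply/negP => xm1.
    have /= := s_max x; rewrite /below xm1 Em1x => /(_ isT).
    by rewrite leqNgt; case/andP: x_in => ->.
  have [x' xx' lx'] := has_least x.
  have x'x : x' <= x by move/leastP: lx'; apply; rewrite e_sym.
  have Em1x' : E m1 x' by apply: (E_trans x) => //; apply: eE.
  have em1x : e m1 x.
    case: (ltngtP x' m1) => [lt|lt|/val_inj <-]; last by rewrite e_sym.
      case: (ord_leVlt m1x) => [<- // | {}m1x].
      have /ord_leVlt[-> // | xt] : x <= t by case/andP: x_in.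
      rewrite (e_trans x') // 1?e_sym //.
      by rewrite (nc_e x' m1 x t) // e_sym.
    have /= := m1_max x'; rewrite /cand lx'.
    have -> : [exists y0 : 'I_m, (y0 < x') && E x' y0].
      by apply/existsP; exists m1; rewrite lt E_sym.
    by move=> /(_ isT); rewrite /= leqNgt lt.
  have m1y : e m1 y by apply: (e_trans x).
  by rewrite [y <= t](t_max y m1y) andbT (leq_trans sm1) ?m1_least.
move=> x y xy; rewrite /cut; apply/idP/idP; first exact: sat1.
by apply: sat1; rewrite e_sym.
Qed.

(** In a saturated interval, [t] is the maximum of its class and [s] the largest
    point of its class below [t].  The merged relation tells which two classes
    have been joined, and the class playing the part of [t] cannot play the part
    of [s], as [s] and [s'] would then each lie strictly to the left of the
    other. *)
Lemma saturated_merge_inj (m : nat) (e : rel 'I_m) (s t s' t' : 'I_m) :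
  equivalence_rel e -> s < t -> s' < t' ->
  saturated e s t -> saturated e s' t' ->
  merge_rel e s t =2 merge_rel e s' t' -> s = s' /\ t = t'.
Proof.
move=> equiv_e st st' sat sat' E.
have [e_refl e_sym] := (equiv_refl equiv_e, equiv_sym equiv_e).
have inT := saturated_target_max st sat.
have inT' := saturated_target_max st' sat'.
have inT_ x : e x t -> s < x <= t by rewrite e_sym; apply: inT.
have inT_' x : e x t' -> s' < x <= t' by rewrite e_sym; apply: inT'.
have outS := saturated_source_out sat.
have outS' x : e x s' -> (x <= s') || (t' < x).
  by rewrite e_sym; apply: (saturated_source_out sat').
have := E s t; rewrite /merge_rel !e_refl orbT => /esym.
case/or3P => [ est | /andP[ss tt] | /andP[s_t t_s]].
- by have := outS _ est; have := inT t (e_refl t); lia.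
- have := outS _ ss; have := outS' _ ss; have := inT_ _ tt; have := inT' _ tt.
  by move=> *; split; apply: val_inj => /=; lia.
- by have := inT_ _ t_s; have := inT_' _ s_t; lia.
Qed.

Lemma saturated_not_related (m : nat) (e : rel 'I_m) (s t : 'I_m) :
  s < t -> saturated e s t -> ~~ e s t.
Proof. by move=> st sat; apply/negP => /sat; rewrite /cut ltnn st leqnn. Qed.

Lemma noncrossing_rel_eq (m : nat) (e e' : rel 'I_m) :
  e =2 e' -> noncrossing_rel e -> noncrossing_rel e'.
Proof. by move=> ee nc a b c d; rewrite -!ee; apply: nc. Qed.

Lemma noncrossing_partition (n : nat) (P : {set {set 'I_n.+1}}) :
  noncrossing P -> partition P [set: 'I_n.+1].
Proof. by case/andP. Qed.

Lemma noncrossing_relP (n : nat) (P : {set {set 'I_n.+1}}) :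
  partition P [set: 'I_n.+1] ->
  reflect (noncrossing_rel (same_block P)) (noncrossing P).
Proof.
move=> partP; rewrite /noncrossing partP /=.
case/and3P: partP => /eqP covP tiP P0.
have inP x : x \in cover P by rewrite covP.
apply: (iffP forall_inP) => [nc a b c d ab bc cd ac bd | nc B BP].
  have /forall_inP/(_ (pblock P b))/(_ (pblock_mem (inP b))) :=
    nc _ (pblock_mem (inP a)).
  rewrite eq_pblock // => /implyP; apply.
  apply/exists_inP; exists a; first by rewrite mem_pblock.
  apply/exists_inP; exists c => //.
  apply/exists_inP; exists b; first by rewrite mem_pblock.
  by apply/exists_inP; exists d => //; rewrite ab bc cd.
apply/forall_inP => B' B'P; apply/implyP.
case/exists_inP=> a aB /exists_inP[c cB /exists_inP[b bB' /exists_inP[d dB']]].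
case/and3P=> ab bc cd.
rewrite -(def_pblock tiP BP aB) -(def_pblock tiP B'P bB') eq_pblock //.
apply: (nc a b c d) => //; first by rewrite /same_block (def_pblock tiP BP aB).
by rewrite /same_block (def_pblock tiP B'P bB').
Qed.

(** * Graphs of arcs *)

Definition linked (n : nat) (A : seq (pos_root n)) : rel 'I_n.+1 :=
  connect (arc_rel A).

Lemma linked_equiv (n : nat) (A : seq (pos_root n)) :
  equivalence_rel (linked A).
Proof.
have sym : connect_sym (arc_rel A).
  by apply: sym_connect_sym => x y; apply: eq_has => r; rewrite orbC.
apply/equivalence_relP; split=> [x|x y xy z]; first exact: connect0.
exact: (same_connect sym xy).
Qed.

Lemma linked_sym (n : nat) (A : seq (pos_root n)) : symmetric (linked A).
Proof. exact: equiv_sym (linked_equiv A). Qed.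

Lemma arc_lt (n : nat) (r : pos_root n) : arc_source r < arc_target r.
Proof. by rewrite /arc_source /arc_target /= /bump /= add1n ltnS (valP r). Qed.

Lemma arc_inj (n : nat) (r r' : pos_root n) :
  arc_source r = arc_source r' -> arc_target r = arc_target r' -> r = r'.
Proof.
case: r r' => [[i j] /= ij] [[i' j'] /= ij'].
rewrite /arc_source /arc_target /= => /(congr1 val) /= /val_inj ii.
by move=> /lift_inj jj; apply: val_inj; rewrite /= ii jj.
Qed.

Lemma arc_exists (n : nat) (s t : 'I_n.+1) : s < t ->
  exists r : pos_root n, arc_source r = s /\ arc_target r = t.
Proof.
move=> st; have sn : s < n by apply: leq_trans st _; rewrite -ltnS.
have tn : t.-1 < n by case: t st => -[|t] /=; lia.
have le : (Ordinal sn, Ordinal tn).1 <= (Ordinal sn, Ordinal tn).2.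
  by rewrite /=; case: t st tn => -[|t] /=; lia.
exists (exist _ (Ordinal sn, Ordinal tn) le); split; apply: val_inj => //=.
by rewrite /bump /= add1n prednK //; case: (nat_of_ord t) st.
Qed.

Lemma linked_nil (n : nat) : @linked n [::] =2 eq_op.
Proof.
move=> x y; apply/idP/eqP => [/connectP[[|z p] //= ] | ->].
exact: connect0.
Qed.

Lemma linked_rcons (n : nat) (A : seq (pos_root n)) (r : pos_root n) :
  linked (rcons A r) =2 merge_rel (linked A) (arc_source r) (arc_target r).
Proof.
have refl := equiv_refl (linked_equiv A).
have trans := equiv_trans (linked_equiv A).
move=> x y; apply/idP/idP; last first.
  apply: merge_rel_sub; first exact: linked_equiv.
    move=> {}x {}y; apply: connect_sub => {}x {}y xy; apply: connect1.
    by rewrite /arc_rel has_rcons [has _ _]xy orbT.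
  by apply: connect1; rewrite /arc_rel has_rcons !eqxx.
case/connectP=> p + ->; elim: p x => [|z p IH] x /=.
  by rewrite /merge_rel refl.
case/andP=> xz /IH; move: (last z p) => {}y {p IH}.
move: xz; rewrite /arc_rel has_rcons -/(arc_rel A x z) /merge_rel.
case/orP=> [/orP[/andP[/eqP-> /eqP->]|/andP[/eqP-> /eqP->]] | /connect1 xz].
- case/or3P=> [-> | /andP[st' ->] | /andP[_ ->]]; rewrite ?refl ?orbT //.
- case/or3P=> [-> | /andP[st' ->] | /andP[_ ->]]; rewrite ?refl ?orbT //.
- case/or3P=> [zy | /andP[zs ->] | /andP[zt ->]].
  + by rewrite (trans _ _ _ xz zy).
  + by rewrite (trans _ _ _ xz zs) ?orbT.
  + by rewrite (trans _ _ _ xz zt) ?orbT.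
Qed.

Lemma arc_components_partition (n : nat) (A : seq (pos_root n)) :
  partition (arc_components A) [set: 'I_n.+1].
Proof.
by apply: equivalence_partitionP => x y z _ _ _; apply: linked_equiv.
Qed.

Lemma same_block_arc_components (n : nat) (A : seq (pos_root n)) :
  same_block (arc_components A) =2 linked A.
Proof.
move=> x y; rewrite /same_block pblock_equivalence_partition ?inE //.
by move=> ? ? ? _ _ _; apply: linked_equiv.
Qed.

(** The condition, symmetric in the ends of [r'], to which the vanishing of the
    Seifert form of [r] against an earlier [r'] amounts. *)
Definition arc_compatible (n : nat) (r' r : pos_root n) : bool :=
  cut (arc_source r) (arc_target r) (arc_source r')
    == cut (arc_source r) (arc_target r) (arc_target r').

Definition compatible_seq (n : nat) (A : seq (pos_root n)) : bool :=
  pairwise (@arc_compatible n) A.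

(** A cut that separates the ends of no arc separates the ends of no path. *)
Lemma compatible_saturated (n : nat) (A : seq (pos_root n)) (r : pos_root n) :
  all (@arc_compatible n ^~ r) A <->
  saturated (linked A) (arc_source r) (arc_target r).
Proof.
split=> [/allP compA x y | sat].
  case/connectP=> p + ->; elim: p x => //= z p IH x /andP[/hasP[r' r'A xz]].
  move/IH <-; have /eqP compr := compA _ r'A.
  by case/orP: xz => /andP[/eqP-> /eqP->]; rewrite compr.
apply/allP => r' r'A; apply/eqP; apply: sat; apply: connect1.
by apply/hasP; exists r' => //; rewrite !eqxx.
Qed.

Lemma compatible_seq_rcons (n : nat) (A : seq (pos_root n)) (r : pos_root n) :
  compatible_seq (rcons A r) <->
  compatible_seq A /\ saturated (linked A) (arc_source r) (arc_target r).
Proof.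
rewrite /compatible_seq pairwise_rcons; split.
  by case/andP => /compatible_saturated.
by case=> -> /compatible_saturated ->.
Qed.

Lemma compatible_noncrossing (n : nat) (A : seq (pos_root n)) :
  compatible_seq A -> noncrossing (arc_components A).
Proof.
move=> compA; apply/noncrossing_relP; first exact: arc_components_partition.
suff nc: noncrossing_rel (linked A).
  by move=> a b c d; rewrite !same_block_arc_components; apply: nc.
elim/last_ind: A compA => [_ | A r IH /compatible_seq_rcons[/IH nc sat]].
  move=> a b c d ab bc _; rewrite linked_nil => /eqP ac.
  by move: bc; rewrite -ac ltnNge ltnW.
apply: (noncrossing_rel_eq (fun x y => esym (linked_rcons A r x y))).
apply: noncrossing_merge => //; [exact: linked_equiv | exact: arc_lt].
Qed.

Lemma arc_components_merge (n : nat) (A : seq (pos_root n)) (r : pos_root n)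
    (P := arc_components A) (Q := arc_components (rcons A r))
    (B := pblock P (arc_source r))
    (B' := pblock P (arc_target r)) :
  Q = (B :|: B') |: (P :\ B :\ B').
Proof.
have partQ : partition Q setT := arc_components_partition (rcons A r).
have /and3P[/eqP covP tiP P0] := arc_components_partition A.
have inB x : (x \in B) = linked A (arc_source r) x.
  exact: same_block_arc_components.
have inB' x : (x \in B') = linked A (arc_target r) x.
  exact: same_block_arc_components.
have inP x : x \in cover P by rewrite covP.
have blockQ x : pblock Q x =
    if (x \in B) || (x \in B') then B :|: B' else pblock P x.
  apply/setP => y.
  rewrite -[LHS]/(same_block _ x y) same_block_arc_components linked_rcons.
  have PE : (y \in pblock P x) = linked A x y.
    exact: same_block_arc_components.
  rewrite inB inB'.
  have /equivalence_relP[refl ltrans] := linked_equiv A.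
  rewrite /merge_rel; case: ifP => [|/norP[/negPf xs /negPf xt]]; last first.
    rewrite (linked_sym A x (arc_source _)) (linked_sym A x (arc_target _)).
    by rewrite xs xt !orbF.
  rewrite inE inB inB'; case/orP => /ltrans xE; rewrite -!xE refl.
    by case: (linked A (arc_source r) y); rewrite ?andbF ?orbF.
  by case: (linked A (arc_target r) y); rewrite ?andbF ?orbT ?orbF.
have BQ x : pblock Q x \in Q.
  by apply: pblock_mem; case/and3P: partQ => /eqP->.
have sB : arc_source r \in B by rewrite mem_pblock.
have tB : arc_target r \in B' by rewrite mem_pblock.
apply/setP => X; rewrite !inE; apply/idP/idP.
  move=> XQ; have [x xX] : exists x, x \in X.
    by apply/set0Pn; case/and3P: partQ => _ _; apply: contraNneq => <-.
  have <- : pblock Q x = X.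
    by case/and3P: partQ => _ tiQ _; apply: def_pblock.
  rewrite blockQ; case: ifP => [_|/norP[nB nB']]; first by rewrite eqxx.
  rewrite pblock_mem // andbT.
  rewrite (contraNneq _ nB') ?(contraNneq _ nB) ?orbT // => <-;
    by rewrite mem_pblock.
case/orP=> [/eqP-> | /and3P[XB' XB XP]].
  by have := BQ (arc_source r); rewrite blockQ sB.
have [x xX] : exists x, x \in X by apply/set0Pn; apply: contraNneq P0 => <-.
have xE := def_pblock tiP XP xX.
have := BQ x; rewrite blockQ xE; case: ifP => // /orP[xB|xB].
  by case/eqP: XB; rewrite -xE (def_pblock tiP _ xB) // pblock_mem.
by case/eqP: XB'; rewrite -xE (def_pblock tiP _ xB) // pblock_mem.
Qed.

(** The two ends of an arc with saturated cut lie in different components, so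
    every new arc lowers the number of components by one. *)
Lemma card_arc_components (n : nat) (A : seq (pos_root n)) :
  compatible_seq A -> #|arc_components A| + size A = n.+1.
Proof.
elim/last_ind: A => [_ | A r IH /compatible_seq_rcons[/IH cardA sat]].
  rewrite addn0.
  have -> : @arc_components n [::] = [set [set x] | x in [set: 'I_n.+1]].
    apply: eq_imset => x; apply/setP => y; rewrite !inE.
    by rewrite -[connect _ _ _]/(linked [::] x y) linked_nil eq_sym.
  by rewrite card_imset ?cardsT ?card_ord //; apply: set1_inj.
rewrite size_rcons arc_components_merge.
set P := arc_components A in cardA *; set B := pblock P _; set B' := pblock P _.
have /and3P[/eqP covP tiP P0] := arc_components_partition A.
have inP x : x \in cover P by rewrite covP.
have BB' : B != B'.
  rewrite eq_pblock //; have := same_block_arc_components A.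
  rewrite /same_block => ->; exact: saturated_not_related (arc_lt r) sat.
have BP : B \in P by rewrite pblock_mem.
have B'P : B' \in P by rewrite pblock_mem.
have notin : (B :|: B') \notin P :\ B :\ B'.
  rewrite !inE; apply/and3P => -[_ /eqP UB UP].
  have sB : arc_source r \in B by rewrite mem_pblock.
  by apply: UB; rewrite -(def_pblock tiP UP (x := arc_source r)) // inE sB.
have cardP := cardsD1 B P; have cardPB := cardsD1 B' (P :\ B).
rewrite !inE B'P eq_sym BB' /= in cardPB.
by rewrite cardsU1 notin -[RHS]cardA cardP BP cardPB !add1n addnS !addSn.
Qed.

(** * The Seifert form *)

Local Open Scope ring_scope.

(** Multiplying a coordinate vector by the Seifert matrix takes its successive
    differences, with the value 0 before the first coordinate.  In the two
    indicators, [j] is the vertex at the left of the [j]-th simple root and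
    [j.+1] the vertex at its right. *)
Lemma mulmx_seifert (n : nat) (r : pos_root n) (j : 'I_n)
    (s := arc_source r) (t := arc_target r) :
  (root_vec r *m seifert_mx n) 0 j = (s < j.+1 <= t)%N%:Z - (s < j <= t)%N%:Z.
Proof.
have tE : t = (val r).2.+1 :> nat by rewrite /t /arc_target /= /bump /= add1n.
have {}tE k : (k.+1 <= t)%N = (k <= (val r).2)%N by rewrite tE.
rewrite mxE (eq_bigr (fun i : 'I_n => (if i == j then root_vec r 0 i else 0)
    - (if i.+1 == j then root_vec r 0 i else 0))); last first.
  move=> i _; rewrite mxE [i.+1 == _]eq_sym; case: eqP => [->|ij].
    by rewrite ltn_eqF // subr0 mulr1.
  by case: ifP => _; rewrite ?mulrN1 ?mulr0 ?subr0 ?sub0r.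
rewrite sumrB -!big_mkcond big_pred1_eq root_vecE tE; congr (_ - _).
case: j => -[|j] jn /=; first by rewrite big_pred0.
by rewrite (big_pred1 (Ordinal (ltnW jn))) // root_vecE tE.
Qed.

Lemma seifert_root_vec (n : nat) (r r' : pos_root n)
    (cut_r := cut (arc_source r) (arc_target r)) :
  seifert (root_vec r) (root_vec r') =
    (cut_r (arc_target r'))%:Z - (cut_r (arc_source r'))%:Z.
Proof.
rewrite /seifert mxE.
under eq_bigr => j _ do rewrite mulmx_seifert mxE root_vecE.
pose g k : int := (arc_source r < k <= arc_target r)%N%:Z.
transitivity (\sum_(arc_source r' <= j < arc_target r') (g j.+1 - g j)).
  rewrite -(big_mkord xpredT (fun j => (g j.+1 - g j) *
    ((val r').1 <= j <= (val r').2)%N%:Z)).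
  have tn : (arc_target r' <= n)%N by rewrite -ltnS.
  rewrite [RHS](big_nat_widen _ _ n _ _ tn).
  rewrite [RHS](big_nat_widenl _ 0%N n _ _ (leq0n _)).
  rewrite [RHS]big_mkcond /=; apply: eq_bigr => j _.
  rewrite /bump /= add1n ltnS andbC.
  by case: (_ && _); rewrite ?mulr1 ?mulr0.
by rewrite telescope_sumr // ltnW // arc_lt.
Qed.

Lemma seifert_root_vec_self (n : nat) (r : pos_root n) :
  seifert (root_vec r) (root_vec r) = 1.
Proof. by rewrite seifert_root_vec /cut ltnn arc_lt leqnn. Qed.

Lemma seifert_root_vec_eq0 (n : nat) (r r' : pos_root n) :
  seifert (root_vec r) (root_vec r') = 0 <-> arc_compatible r' r.
Proof.
rewrite seifert_root_vec /arc_compatible.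
by case: (cut _ _ _); case: (cut _ _ _).
Qed.

(** The Gram matrix [M S M^T] is unitriangular, so its determinant
    [det M * det S * det M] is 1 and [M] is invertible over the integers. *)
Lemma seifert_triangular_basis (n : nat) (b : 'I_n -> 'rV[int]_n) :
  (forall i, seifert (b i) (b i) = 1) ->
  (forall i j : 'I_n, (i < j)%N -> seifert (b j) (b i) = 0) ->
  lattice_basis b.
Proof.
move=> b1 b0; pose M : 'M[int]_n := \matrix_(i, j) b i 0 j.
have rowM i : row i M = b i by apply/rowP => j; rewrite !mxE.
have gram i j : (M *m seifert_mx n *m M^T) i j = seifert (b i) (b j).
  rewrite /seifert -!rowM -row_mul mxE [RHS]mxE; apply: eq_bigr => k _.
  by rewrite !mxE.
have trig : is_trig_mx (M *m seifert_mx n *m M^T)^T.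
  by apply/is_trig_mxP => i j ij; rewrite mxE gram b0.
have det1 : \det (M *m seifert_mx n *m M^T) = 1.
  rewrite -det_tr det_trig // big1 // => i _.
  by rewrite mxE gram b1.
have Munit : M \in unitmx.
  rewrite unitmxE; apply/unitrPr; exists (\det (seifert_mx n) * \det M).
  by rewrite -det1 !det_mulmx det_tr mulrA.
have sumE (c : 'rV[int]_n) : \sum_(i < n) c 0 i *: b i = c *m M.
  apply/rowP => j; rewrite summxE mxE; apply: eq_bigr => i _.
  by rewrite !mxE.
move=> x; exists (x *m invmx M); split; first by rewrite sumE mulmxKV.
by move=> c ->; rewrite sumE mulmxK.
Qed.
Local Close Scope ring_scope.

Lemma compatible_seqP (n : nat) (A : n.-tuple (pos_root n)) :
  compatible_seq A <->
  (forall i j : 'I_n, i < j -> arc_compatible (tnth A i) (tnth A j)).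
Proof.
case: n A => [|n] A; first by split=> [_ []|_]; rewrite ?tuple0.
have x0 := tnth A ord0.
split=> [/(pairwiseP x0) H i j ij | H].
  by rewrite !(tnth_nth x0); apply: H; rewrite ?inE ?size_tuple.
apply/(pairwiseP x0) => i j; rewrite !inE size_tuple => i_n j_n ij.
by have := H (Ordinal i_n) (Ordinal j_n) ij; rewrite !(tnth_nth x0).
Qed.

Lemma distinguished_compatible (n : nat) (A : n.-tuple (pos_root n)) :
  distinguished A <-> compatible_seq A.
Proof.
rewrite compatible_seqP; split=> [[_ H] i j ij | H].
  by apply/seifert_root_vec_eq0/H.
have orth (i j : 'I_n) : i < j ->
    seifert (root_vec (tnth A j)) (root_vec (tnth A i)) = 0%R.
  by move=> /H/seifert_root_vec_eq0.
split=> //; apply: seifert_triangular_basis => // i.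
exact: seifert_root_vec_self.
Qed.

(** * Maximal chains *)

Lemma compatible_take (n : nat) (A : seq (pos_root n)) (k : nat) :
  compatible_seq A -> compatible_seq (take k A).
Proof. exact/subseq_pairwise/take_subseq. Qed.

Lemma take_tuple_rcons (T : Type) (n : nat) (A : n.-tuple T) (k : 'I_n) :
  take k.+1 A = rcons (take k A) (tnth A k).
Proof. by rewrite (tnth_nth (tnth A k)) -take_nth ?size_tuple. Qed.

Lemma compatible_tuple_saturated (n : nat) (A : n.-tuple (pos_root n))
    (k : 'I_n) :
  compatible_seq A ->
  saturated (linked (take k A)) (arc_source (tnth A k)) (arc_target (tnth A k)).
Proof.
move=> /(compatible_take k.+1); rewrite take_tuple_rcons.
by case/compatible_seq_rcons.
Qed.

Lemma refines_discrete (n : nat) (P : {set {set 'I_n.+1}}) :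
  partition P [set: 'I_n.+1] -> refines (@arc_components n [::]) P.
Proof.
move=> partP; apply/refinesP => //; first exact: arc_components_partition.
move=> x y; rewrite same_block_arc_components linked_nil => /eqP<-.
exact: equiv_refl (same_block_equiv partP) x.
Qed.

Lemma compatible_full (n : nat) (A : seq (pos_root n)) :
  compatible_seq A -> size A = n -> arc_components A = [set [set: 'I_n.+1]].
Proof.
move=> /card_arc_components + sA; rewrite sA -[RHS]add1n.
case/addIn/eqP/cards1P=> X PX.
have /and3P[/eqP + _ _] := arc_components_partition A.
by rewrite PX /cover big_set1 => ->.
Qed.

Lemma refines_full (T : finType) (P : {set {set T}}) :
  refines P [set [set: T]].
Proof.
apply/forall_inP => B _.
by apply/exists_inP; exists setT; rewrite ?inE ?subsetT.
Qed.

Lemma noncrossing_full (n : nat) : noncrossing [set [set: 'I_n.+1]].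
Proof.
apply/andP; split.
  rewrite /partition /cover big_set1 eqxx /= inE eq_sym; apply/andP; split.
    by apply/trivIsetP => B C /set1P-> /set1P->; rewrite eqxx.
  by apply/set0Pn; exists ord0.
apply/forall_inP => B /set1P->; apply/forall_inP => C /set1P->.
by rewrite eqxx implybT.
Qed.

Lemma arc_components_rcons_strict (n : nat) (A : seq (pos_root n))
    (r : pos_root n) :
  compatible_seq (rcons A r) ->
  strictly_refines (arc_components A) (arc_components (rcons A r)).
Proof.
move=> /compatible_seq_rcons[_ sat]; apply/andP; split.
  apply/refinesP; try exact: arc_components_partition.
  move=> x y; rewrite !same_block_arc_components linked_rcons /merge_rel.
  by move=> ->.
apply: contraNneq (saturated_not_related (arc_lt r) sat) => E.
rewrite -same_block_arc_components E same_block_arc_components linked_rcons.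
by rewrite /merge_rel !(equiv_refl (linked_equiv A)) orbT.
Qed.

(** An intermediate partition is decided by whether it relates the two ends of
    the new arc. *)
Lemma arc_components_rcons_cover (n : nat) (A : seq (pos_root n))
    (r : pos_root n) (X : {set {set 'I_n.+1}}) :
  partition X [set: 'I_n.+1] ->
  refines (arc_components A) X -> refines X (arc_components (rcons A r)) ->
  X = arc_components A \/ X = arc_components (rcons A r).
Proof.
move=> partX AX XA.
have partA := arc_components_partition A.
have partAr := arc_components_partition (rcons A r).
have /(refinesP partA partX) sAX := AX.
have /(refinesP partX partAr) sXA := XA.
have X_sym := equiv_sym (same_block_equiv partX).
have X_trans := equiv_trans (same_block_equiv partX).
have AXl x y : linked A x y -> same_block X x y.
  by move=> xy; apply: sAX; rewrite same_block_arc_components.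
have [st|st] := boolP (same_block X (arc_source r) (arc_target r));
  [right | left].
  apply: refines_anti => //; apply/refinesP => // x y.
  rewrite same_block_arc_components linked_rcons.
  exact: (merge_rel_sub (same_block_equiv partX)).
apply: refines_anti => //; apply/refinesP => // x y xy.
have := sXA x y xy; rewrite !same_block_arc_components linked_rcons.
case/or3P=> [// | /andP[/AXl xs /AXl ty] | /andP[/AXl xt /AXl sy]].
  case/negP: st; rewrite X_sym in xs; rewrite X_sym in ty.
  exact: (X_trans _ _ _ xs (X_trans _ _ _ xy ty)).
case/negP: st; rewrite X_sym; rewrite X_sym in xt; rewrite X_sym in sy.
exact: (X_trans _ _ _ xt (X_trans _ _ _ xy sy)).
Qed.

Lemma nc_chain_comparable (n : nat) (c : seq {set {set 'I_n.+1}})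
    (X Y : {set {set 'I_n.+1}}) :
  nc_chain c -> X \in c -> Y \in c -> refines X Y \/ refines Y X.
Proof.
case=> _ /(sub_sorted (e' := @refines _)) sc.
have {}sc : pairwise (@refines _) c.
  rewrite -sorted_pairwise; last exact: refines_trans.
  by apply: sc => P Q /andP[].
move=> /(nthP X)[i ic <-] /(nthP X)[j jc <-].
case: (ltngtP i j) => [ij|ji|->].
- by left; apply: (pairwiseP X sc).
- by right; apply: (pairwiseP X sc).
- by left; apply/forall_inP => B BP; apply/exists_inP; exists B.
Qed.

Lemma Pi_map_nc_chain (n : nat) (A : n.-tuple (pos_root n)) :
  compatible_seq A -> nc_chain (Pi_map A).
Proof.
move=> compA; split.
  apply/allP => X /mapP[k _ ->]; apply: compatible_noncrossing.
  exact: compatible_take.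
apply/(sortedP set0) => k; rewrite size_mkseq ltnS => kn.
rewrite !nth_mkseq //; last exact: ltnW.
rewrite (take_tuple_rcons A (Ordinal kn)); apply: arc_components_rcons_strict.
by rewrite -(take_tuple_rcons A (Ordinal kn)); apply: compatible_take.
Qed.

(** A member [X] of a larger chain is comparable with every partition of the
    image, so between the last one that refines [X] and the next one there is
    only room for these two. *)
Lemma Pi_map_maximal (n : nat) (A : n.-tuple (pos_root n)) :
  compatible_seq A -> maximal_nc_chain (Pi_map A).
Proof.
move=> compA; have chA := Pi_map_nc_chain compA; split=> // c' chc' sub.
have partc X : X \in c' -> partition X [set: 'I_n.+1].
  by case: chc' => /allP nc' _ /nc'/noncrossing_partition.
have inPi k : k <= n -> arc_components (take k A) \in Pi_map A.
  by move=> kn; apply/mapP; exists k; rewrite ?mem_iota.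
suff c'sub : {subset c' <= Pi_map A}.
  apply: (irr_sorted_eq_in (leT := @strictly_refines _)).
  - move=> Q P R /partc partQ /partc partP /partc partR.
    case/andP=> PQ nPQ /andP[QR nQR].
    rewrite /strictly_refines (refines_trans PQ QR) /=.
    by apply: contraNneq nPQ => PR; apply/eqP/refines_anti; rewrite // PR.
  - by move=> P _; rewrite /strictly_refines eqxx andbF.
  - by case: chc'.
  - by case: chA.
  - by move=> X; apply/idP/idP; [apply: c'sub | apply: sub].
move=> X Xc'; have partX := partc X Xc'.
have step k :
    k <= n -> X \in Pi_map A \/ refines (arc_components (take k A)) X.
  elim: k => [_ | k IH kn].
    by rewrite take0; right; apply: refines_discrete.
  have [|AX] := IH (ltnW kn); first by left.
  have := nc_chain_comparable chc' Xc' (sub _ (inPi _ kn)).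
  have := inPi k.+1 kn; rewrite (take_tuple_rcons A (Ordinal kn)) => inr.
  case=> [XA|]; last by right.
  left; have [->|->//] := arc_components_rcons_cover partX AX XA.
  by apply: inPi; apply: ltnW.
have [//|] := step n (leqnn n).
have := inPi n (leqnn n); rewrite take_oversize ?size_tuple // => topA AX.
suff -> : X = arc_components A by [].
apply: refines_anti => //; first exact: arc_components_partition.
by rewrite (compatible_full compA) ?size_tuple ?refines_full.
Qed.

(** Arcs are added one at a time, each inside a block of the first member of
    the chain that differs from the current partition, so that the current
    partition keeps refining the rest of the chain.  Once the chain is used up,
    the partition with a single block serves as target. *)
Lemma nc_chain_extension (n : nat) (A : seq (pos_root n))
    (c : seq {set {set 'I_n.+1}}) :
  compatible_seq A -> size A <= n ->
  all (@noncrossing n) c -> pairwise (@refines _) c ->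
  all (refines (arc_components A)) c ->
  exists B, [/\ compatible_seq (A ++ B), size (A ++ B) = n &
    forall X, X \in c ->
      exists2 k, k <= n & X = arc_components (take k (A ++ B))].
Proof.
move En : (n - size A) => d.
elim: d A c En => [|d IH] A c En compA sA ncc srt Ac.
  have {}sA : size A = n by lia.
  exists [::]; rewrite cats0; split=> // X Xc; exists n => //.
  rewrite take_oversize ?sA //.
  have /noncrossing_partition partX := allP ncc X Xc.
  apply: refines_anti => //; first exact: arc_components_partition.
    by rewrite (compatible_full compA) ?refines_full.
  exact: (allP Ac).
pose c' := [seq X <- c | X != arc_components A].
pose Q := head [set [set: 'I_n.+1]] c'.
have sub_c' X : X \in c' -> X \in c by rewrite mem_filter => /andP[].
have srt' : pairwise (@refines _) c' by apply: pairwise_filter.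
have [ncQ AQ nAQ Qc'] : [/\ noncrossing Q, refines (arc_components A) Q,
    Q != arc_components A & all (refines Q) c'].
  rewrite /Q; case E : c' => [|X c''] /=.
    split=> //; [exact: noncrossing_full | exact: refines_full |].
    apply/eqP => full; have := card_arc_components compA.
    by rewrite -full cards1; lia.
  have Xc' : X \in c' by rewrite E mem_head.
  have XX : refines X X by apply/forall_inP => B ?; apply/exists_inP; exists B.
  rewrite XX; split.
  - exact: (allP ncc) _ (sub_c' _ Xc').
  - exact: (allP Ac) _ (sub_c' _ Xc').
  - by move: Xc'; rewrite mem_filter => /andP[].
  - by move: srt'; rewrite E /= => /andP[].
have partQ := noncrossing_partition ncQ.
have partA := arc_components_partition A.
have [||||||s [t [st Qst sat]]] :=
    @exists_saturated_interval _ (same_block (arc_components A)) (same_block Q).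
- exact: same_block_equiv.
- exact: same_block_equiv.
- exact/refinesP.
- exact/noncrossing_relP/compatible_noncrossing.
- exact/noncrossing_relP.
- by move=> QA; case/eqP: nAQ; apply: refines_anti => //; apply/refinesP.
have [r [rs rt]] := arc_exists st.
have compAr : compatible_seq (rcons A r).
  apply/compatible_seq_rcons; split=> // x y xy; rewrite rs rt.
  by apply: sat; rewrite same_block_arc_components.
have ArQ : refines (arc_components (rcons A r)) Q.
  apply/refinesP => //; first exact: arc_components_partition.
  move=> x y; rewrite same_block_arc_components linked_rcons rs rt.
  apply: (merge_rel_sub (same_block_equiv partQ)) => // {}x {}y.
  by rewrite -same_block_arc_components; move/(refinesP partA partQ): AQ; apply.
have [||||||B] := IH (rcons A r) c'.
- by rewrite size_rcons subnS En.
- by [].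
- by rewrite size_rcons -subn_gt0 En.
- by apply/allP => X /sub_c'; apply: (allP ncc).
- by [].
- by apply/allP => X /(allP Qc'); apply: refines_trans.
rewrite cat_rcons => -[compB sizeB inB]; exists (r :: B); split=> // X Xc.
have [->|nX] := eqVneq X (arc_components A).
  by exists (size A); rewrite // take_size_cat.
by apply: inB; rewrite mem_filter nX.
Qed.

Lemma maximal_nc_chain_in_image (n : nat) (c : seq {set {set 'I_n.+1}}) :
  maximal_nc_chain c ->
  exists2 A : n.-tuple (pos_root n), compatible_seq A & Pi_map A = c.
Proof.
case=> -[ncc srt] maxc.
have [|||||B [compB sizeB inB]] := @nc_chain_extension n [::] c.
- by [].
- by [].
- by [].
- rewrite -sorted_pairwise; last exact: refines_trans.
  by apply: sub_sorted srt => P Q /andP[].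
- by apply/allP => X /(allP ncc)/noncrossing_partition/refines_discrete.
have sB : size B == n by apply/eqP.
exists (Tuple sB) => //; apply: maxc; first exact: Pi_map_nc_chain.
by move=> X /inB[k kn ->]; apply/mapP; exists k; rewrite ?mem_iota.
Qed.

Lemma Pi_map_inj (n : nat) (A A' : n.-tuple (pos_root n)) :
  compatible_seq A -> compatible_seq A' -> Pi_map A = Pi_map A' -> A = A'.
Proof.
move=> compA compA' E.
have compE k : k <= n -> linked (take k A) =2 linked (take k A').
  move=> kn x y; rewrite -!same_block_arc_components.
  by have := congr1 (nth set0 ^~ k) E; rewrite !nth_mkseq // => ->.
apply: eq_from_tnth => k; have kn := ltn_ord k.
suff [] : arc_source (tnth A k) = arc_source (tnth A' k) /\
    arc_target (tnth A k) = arc_target (tnth A' k) by apply: arc_inj.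
apply: (@saturated_merge_inj _ (linked (take k A))); try exact: arc_lt.
- exact: linked_equiv.
- exact: compatible_tuple_saturated.
- move=> x y; rewrite compE 1?ltnW //; exact: compatible_tuple_saturated.
- move=> x y; rewrite -linked_rcons -take_tuple_rcons compE // take_tuple_rcons.
  by rewrite linked_rcons /merge_rel !compE // ltnW.
Qed.

(** * The labelling *)

Lemma block_min_le (n : nat) (B : {set 'I_n.+1}) (x : 'I_n.+1) :
  x \in B -> block_min B <= x.
Proof.
move=> xB; rewrite /block_min -minEnat.
exact: (@Order.TotalTheory.bigmin_le_cond _ nat).
Qed.

Lemma block_min_gt (n : nat) (B : {set 'I_n.+1}) (s : nat) :
  s < n -> (forall x, x \in B -> s < x) -> s < block_min B.
Proof.
move=> sn sB; rewrite /block_min.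
by elim/big_ind: _ => // x y sx sy; rewrite leq_min sx.
Qed.

(** The pair of blocks found by [Lambda_step] is the pair of blocks of [s] and
    [t], in this order since every element of the block of [t] exceeds [s]; and
    no element of the block of [s] lies between [s] and [t]. *)
Lemma Lambda_step_rcons (n : nat) (A : seq (pos_root n)) (r : pos_root n) :
  saturated (linked A) (arc_source r) (arc_target r) ->
  Lambda_step (arc_components A) (arc_components (rcons A r)) = arc_source r.
Proof.
move=> sat; set P := arc_components A; set Q := arc_components _.
set s := arc_source r in sat *; set t := arc_target r in sat *.
have st : s < t := arc_lt r.
have /and3P[/eqP covP tiP P0] := arc_components_partition A : partition P setT.
have /and3P[_ tiQ _] := arc_components_partition (rcons A r) : partition Q setT.
have inP x : x \in cover P by rewrite covP.
set B := pblock P s; set B' := pblock P t.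
have sB : s \in B by rewrite mem_pblock.
have outB x : x \in B -> (x <= s) || (t < x).
  rewrite -[x \in B]/(same_block P s x) same_block_arc_components.
  exact: saturated_source_out.
have inB' x : x \in B' -> s < x <= t.
  rewrite -[x \in B']/(same_block P t x) same_block_arc_components.
  exact: saturated_target_max.
have minBB' : block_min B < block_min B'.
  apply: (leq_ltn_trans (block_min_le sB)); apply: block_min_gt.
    by apply: leq_trans st _; rewrite -ltnS.
  by move=> x /inB' /andP[].
have mergeBB' : merges P Q B B'.
  by rewrite /merges !pblock_mem // minBB' /=; apply/eqP/arc_components_merge.
rewrite /Lambda_step; case: pickP => [[C C'] /= | /(_ (B, B'))]; last first.
  by rewrite mergeBB'.
case/and4P=> CP C'P minCC' /eqP QE.
have nonempty X : X \in P -> exists x, x \in X.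
  by move=> XP; apply/set0Pn; apply: contraNneq P0 => <-.
have [[x xC] [x' xC']] := (nonempty _ CP, nonempty _ C'P).
have : linked (rcons A r) x x'.
  rewrite -same_block_arc_components /same_block -/Q.
  rewrite (@def_pblock _ Q (C :|: C')) ?inE ?xC ?xC' ?orbT //.
  by rewrite QE !inE eqxx.
have blockE y z : linked A y z -> pblock P y = pblock P z.
  by rewrite -same_block_arc_components => yz; apply/eqP; rewrite eq_pblock.
have CE := def_pblock tiP CP xC; have CE' := def_pblock tiP C'P xC'.
rewrite linked_rcons.
case/or3P=> [/blockE xx'|/andP[/blockE xs /blockE tx']|
             /andP[/blockE xt /blockE sx']].
- by move: minCC'; rewrite -CE -CE' xx' ltnn.
- have -> : C = B by rewrite -CE xs.
  have -> : C' = B' by rewrite -CE' -tx'.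
  apply/eqP; rewrite eqn_leq; apply/andP; split.
    have tB' : t \in B' by rewrite mem_pblock.
    apply/bigmax_leqP => i /andP[/outB/orP[//|ti] /forall_inP/(_ t tB')].
    by rewrite ltnNge ltnW.
  apply: (bigmax_sup s) => //; rewrite sB; apply/forall_inP => b /inB'.
  by case/andP.
- by move: minCC'; rewrite -CE -CE' xt -sx' ltnNge ltnW.
Qed.

Lemma Lambda_map_mkseq (n m : nat) (f : nat -> {set {set 'I_n.+1}}) :
  Lambda_map (mkseq f m.+1) = mkseq (fun k => Lambda_step (f k) (f k.+1)) m.
Proof.
rewrite /mkseq /=; move: 0 => i.
by elim: m i => //= m IH i; rewrite IH.
Qed.

Lemma Lambda_Pi_map (n : nat) (A : n.-tuple (pos_root n)) :
  compatible_seq A ->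
  [seq l.+1 | l <- Lambda_map (Pi_map A)] = [seq root_in r | r <- A].
Proof.
move=> compA; rewrite Lambda_map_mkseq /mkseq -val_enum_ord -2!map_comp.
rewrite -[in RHS](map_tnth_enum A) -[RHS]map_comp; apply: eq_map => k /=.
rewrite take_tuple_rcons Lambda_step_rcons //.
exact: compatible_tuple_saturated.
Qed.

Theorem theorem1p7 (n : nat) (hn : 1 <= n) :
  [/\ (forall A : n.-tuple (pos_root n),
         distinguished A -> maximal_nc_chain (Pi_map A)),
      (forall c : seq {set {set 'I_n.+1}}, maximal_nc_chain c ->
         exists! A : n.-tuple (pos_root n), distinguished A /\ Pi_map A = c)
    & (forall A : n.-tuple (pos_root n), distinguished A ->
         [seq l.+1 | l <- Lambda_map (Pi_map A)] = [seq root_in r | r <- A])].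
Proof.
split=> [A /distinguished_compatible|c|A /distinguished_compatible].
- exact: Pi_map_maximal.
- case/maximal_nc_chain_in_image => A compA <-.
  exists A; split=> [|A' [/distinguished_compatible compA' E]].
    by split=> //; apply/distinguished_compatible.
  exact: Pi_map_inj.
- exact: Lambda_Pi_map.
Qed.
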